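(* There are continuum-many equational theories of classes of idempotent $0$-semifields; that is, the set $\{\mathrm{Eq}(\mathsf{K})\mid \mathsf{K}\text{ is a class of idempotent }0\text{-semifields}\}$ has cardinality $2^{\aleph_0}$.
   Context: An idempotent semiring is an algebraic structure $\langle S,\vee,\cdot,\mathrm{e}\rangle$ such that $\langle S,\cdot,\mathrm{e}\rangle$ is a monoid, $\langle S,\vee\rangle$ is a semilattice (an idempotent commutative semigroup), and $a(b\vee c)d=abd\vee acd$ for all $a,b,c,d\in S$; it is ordered by $a\le b :\Longleftrightarrow a\vee b=b$. An idempotent $0$-semiring is an algebraic structure $\langle F,\vee,\cdot,\mathrm{e},0\rangle$ such that $\langle F,\vee,\cdot,\mathrm{e}\rangle$ is an idempotent semiring with least element $0$; it is an idempotent $0$-semifield if, additionally, $\langle F\setminus\{0\},\cdot,\mathrm{e}\rangle$ is the monoid reduct of a group. Terms are built from a countably infinite set of variables; an equation $s\approx t$ is satisfied by an algebra $\mathbf{A}$ if $\varphi(s)=\varphi(t)$ for every homomorphism $\varphi$ from the term algebra to $\mathbf{A}$. $\mathrm{Eq}(\mathsf{K})$ is the set of all equations in the signature $\{\vee,\cdot,\mathrm{e},0\}$ satisfied by all members of $\mathsf{K}$. *)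

(* Defs.v *)
From mathcomp Require Import all_boot.
From mathcomp Require Import boolp classical_sets functions cardinality.

Set Implicit Arguments.
Unset Strict Implicit.
Unset Printing Implicit Defensive.

Local Open Scope classical_set_scope.

(* Algebras in the signature {join, mul, one, zero}, without any axiom. *)
Record algebra : Type := Algebra {
  carrier :> Type;
  join : carrier -> carrier -> carrier;
  mul : carrier -> carrier -> carrier;
  one : carrier;
  zero : carrier
}.

Arguments join {_} _ _.
Arguments mul {_} _ _.
Arguments one {_}.
Arguments zero {_}.

Definition is_monoid (T : Type) (op : T -> T -> T) (e : T) : Prop :=
  [/\ associative op, left_id e op & right_id e op].

Definition is_semilattice (T : Type) (op : T -> T -> T) : Prop :=
  [/\ associative op, commutative op & idempotent_op op].

Definition is_idempotent_semiring (A : algebra) : Prop :=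
  [/\ is_monoid (@mul A) one,
      is_semilattice (@join A)
    & forall a b c d : A,
        mul (mul a (join b c)) d = join (mul (mul a b) d) (mul (mul a c) d)].

Definition ale (A : algebra) (a b : A) : Prop := join a b = b.

(* That zero is absorbing for mul is not part of the definition. *)
Definition is_idempotent_zsemiring (A : algebra) : Prop :=
  is_idempotent_semiring A /\ forall a : A, ale zero a.

(* The nonzero elements contain one, are closed under mul, and carry an inverse
   operation; associativity and the unit laws are those of the semiring. *)
Definition nonzero_group (A : algebra) : Prop :=
  [/\ one <> zero :> A,
      forall a b : A, a <> zero -> b <> zero -> mul a b <> zero
    & exists inv : A -> A, forall a : A, a <> zero ->
        [/\ inv a <> zero, mul (inv a) a = one & mul a (inv a) = one]].

Definition is_idempotent_zsemifield (A : algebra) : Prop :=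
  is_idempotent_zsemiring A /\ nonzero_group A.

Inductive term : Type :=
  | Var of nat
  | Join of term & term
  | Mul of term & term
  | One
  | Zero.

Definition term_algebra : algebra := Algebra Join Mul One Zero.

Definition is_hom (A B : algebra) (phi : A -> B) : Prop :=
  [/\ {morph phi : a b / join a b},
      {morph phi : a b / mul a b},
      phi one = one
    & phi zero = zero].

Definition equation : Type := (term * term)%type.

Definition satisfies (A : algebra) (eqn : equation) : Prop :=
  forall phi : term_algebra -> A, is_hom phi -> phi eqn.1 = phi eqn.2.

Definition Eq (K : set algebra) : set equation :=
  [set eqn | forall A : algebra, K A -> satisfies A eqn].

Definition idempotent_zsemifields : set algebra :=
  [set A | is_idempotent_zsemifield A].

(* Main.v *)
Require Import Defs.
From mathcomp Require Import all_boot all_order all_algebra.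
From mathcomp Require Import boolp classical_sets functions cardinality.
From mathcomp Require Import lra.

(** For q > 1, order Z x Q lexicographically and multiply by
    (k, b)(l, c) = (k + l, b q^l + c): this is a totally ordered group in which
    the elements x = (0, b) satisfy x y = y x^(q^l) for y = (l, c).
    In a totally ordered group, a disjunction of inequalities s_i <= t_i
    (i = 1, 2, 3) is the single inequality
    s_1 s_2 s_3 <= max(t_1 s_2 s_3, s_1 t_2 s_3, s_1 s_2 t_3), so the clause
    "x <= e, or x y <= y x^(m-1), or y x^(m+1) <= x y" is an equation between
    joins of products.  For m >= 3 the group of parameter q violates it exactly
    when m is a power of q.  Letting q and m range over the numbers 4n + 6, none
    of which is a proper power of another one (they are 2 modulo 4), gives
    0-semifields A_n and equations eps_m with A_n |= eps_m iff n <> m, whence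
    the theories Eq {A_n | n in S} are pairwise distinct. *)

Import Order.TTheory GRing.Theory Num.Theory.
(* MathComp's algebra library shadows [mul] and [one]. *)
Import Defs.

Set Implicit Arguments.
Unset Strict Implicit.
Unset Printing Implicit Defensive.

Local Open Scope classical_set_scope.
Local Open Scope card_scope.

(** * Adjoining a zero to a semilattice-ordered group *)

Definition adjoin_zero (T : Type) (jn op : T -> T -> T) (e : T) : algebra :=
  {| carrier := option T;
     join := fun a b =>
       match a, b with
       | Some x, Some y => Some (jn x y)
       | Some x, None => Some x
       | None, _ => b
       end;
     mul := fun a b =>
       match a, b with Some x, Some y => Some (op x y) | _, _ => None end;
     one := Some e;
     zero := None |}.

Lemma adjoin_zero_zsemifield (T : Type) (jn op : T -> T -> T) (e : T)
    (inv : T -> T) :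
    is_semilattice jn -> left_distributive op jn -> right_distributive op jn ->
    is_monoid op e -> left_inverse e inv op -> right_inverse e inv op ->
  is_idempotent_zsemifield (adjoin_zero jn op e).
Proof.
move=> [jnA jnC jnxx] opDl opDr [opA op1x opx1] opVx opxV; split; split.
- split.
  + split.
    * by move=> [x|] [y|] [z|] //=; rewrite opA.
    * by move=> [x|] //=; rewrite op1x.
    * by move=> [x|] //=; rewrite opx1.
  + split.
    * by move=> [x|] [y|] [z|] //=; rewrite jnA.
    * by move=> [x|] [y|] //=; rewrite jnC.
    * by move=> [x|] //=; rewrite jnxx.
  + by move=> [a|] [x|] [y|] [b|] //=; rewrite opDr opDl.
- by case.
- by [].
- by move=> [x|] [y|].
- exists (fun a => if a is Some x then Some (inv x) else None).
  by move=> [x|] // _; split=> //=; rewrite ?opVx ?opxV.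
Qed.

(** A strictly increasing map on a total order also reflects the order. Applied to translations,
    this gives distributivity of the product over [max]. *)
Lemma mono_max {d : Order.disp_t} {T : orderType d} (f : T -> T) :
  {homo f : x y / (x < y)%O} -> {morph f : x y / Order.max x y}.
Proof.
by move=> f_lt x y; rewrite /Order.max (leW_mono (le_mono f_lt)); case: ifP.
Qed.

(** In a total order an element is below a maximum iff it is below one of the terms; strictly
    increasing translations then allow common factors to be cancelled. *)
Lemma le_three_products {d : Order.disp_t} {T : orderType d} (op : T -> T -> T)
    (s1 t1 s2 t2 s3 t3 : T) :
    (forall a, {homo op a : x y / (x < y)%O}) ->
    (forall a, {homo op^~ a : x y / (x < y)%O}) ->
  (op (op s1 s2) s3 <=
     Order.max (Order.max (op (op t1 s2) s3) (op (op s1 t2) s3))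
       (op (op s1 s2) t3))%O =
  [|| s1 <= t1, s2 <= t2 | s3 <= t3]%O.
Proof.
move=> op_ltl op_ltr.
have lel a := le_mono (op_ltl a); have ler a := le_mono (op_ltr a).
by rewrite !le_max lel !ler lel orbA.
Qed.

(** * The lexicographically ordered groups *)

Section AffineGroup.

Variables (q : rat).
Hypothesis q_gt0 : (0 < q)%R.

Local Notation G := (int *l rat)%type.

(** For [q] nonzero, this is composition, left factor first, of the affine maps
    [t |-> q ^ k * t + b] coded by [(k, b)]. *)
Definition affine_mul (x y : G) : G := (x.1 + y.1, x.2 * q ^ y.1 + y.2)%R.
Definition affine_one : G := (0, 0)%R.
Definition affine_inv (x : G) : G := (- x.1, - (x.2 * q ^ (- x.1)))%R.

Let q_neq0 : q != 0%R. Proof. by rewrite gt_eqF. Qed.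

Lemma affine_mulA : associative affine_mul.
Proof.
move=> [k b] [l c] [m a]; rewrite /affine_mul /= expfzDr //.
by congr pair; [rewrite addrA | rewrite mulrDl mulrA addrA].
Qed.

Lemma affine_mul1x : left_id affine_one affine_mul.
Proof. by move=> [k b]; rewrite /affine_mul /= add0r mul0r add0r. Qed.

Lemma affine_mulx1 : right_id affine_one affine_mul.
Proof. by move=> [k b]; rewrite /affine_mul /= expr0z mulr1 !addr0. Qed.

Lemma affine_mulVx x : affine_mul (affine_inv x) x = affine_one.
Proof.
case: x => k b; rewrite /affine_mul /affine_one /= addNr; congr pair.
by rewrite mulNr -mulrA -expfzDr // addNr expr0z mulr1 addNr.
Qed.

Lemma affine_mulxV x : affine_mul x (affine_inv x) = affine_one.
Proof.
by case: x => k b; rewrite /affine_mul /affine_one /= subrr subrr.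
Qed.

(** Second coordinates matter only where the first ones agree, and there the left factor contributes
    the same summand to both. *)
Lemma affine_mul_ltl a : {homo affine_mul a : x y / (x < y)%O}.
Proof.
case: a => m a [k b] [l c]; rewrite /affine_mul.
rewrite !Order.ProdLexiOrder.ltEprodlexi /= !lerD2l.
move=> /andP[kl /implyP bc]; rewrite kl; apply/implyP => lk.
by rewrite (le_anti (introT andP (conj kl lk))) ltrD2l bc.
Qed.

Lemma affine_mul_ltr a : {homo affine_mul^~ a : x y / (x < y)%O}.
Proof.
case: a => m a [k b] [l c].
rewrite !Order.ProdLexiOrder.ltEprodlexi /= !lerD2r => /andP[-> /= /implyP bc].
by apply/implyP => /bc; rewrite ltrD2r ltr_pM2r // exprz_gt0.
Qed.

Lemma affine_pow1 (x : G) j :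
  ((iter j (affine_mul x) affine_one).1 = x.1 *+ j)%R.
Proof. by elim: j => [|j IHj] /=; rewrite ?mulr0n // IHj mulrS. Qed.

Lemma affine_pow0 (b : rat) j :
  iter j (affine_mul (0, b)%R) affine_one = (0, b *+ j)%R.
Proof.
elim: j => [|j IHj] //=; rewrite IHj /affine_mul /= expr0z mulr1 mulrS.
by rewrite addr0.
Qed.

End AffineGroup.

(** For [x = (k, b)] and [y = (l, c)], the first coordinates force [k = 0]; then [b > 0] cancels
    from the second ones, leaving [p < n ^ l < p + 2]. *)
Lemma affine_between (n p : nat) (x y : int *l rat) :
    (1 < n)%N -> (1 < p)%N -> (affine_one < x)%O ->
    (affine_mul n%:R y (iter p (affine_mul n%:R x) affine_one)
       < affine_mul n%:R x y)%O ->
    (affine_mul n%:R x y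
       < affine_mul n%:R y (iter p.+2 (affine_mul n%:R x) affine_one))%O ->
  exists j, (n ^ j = p.+1)%N.
Proof.
move=> n_gt1 p_gt1; case: x y => [k b] [l c].
have n_gt0 : (0 < n%:R :> rat)%R by rewrite ltr0n ltnW.
rewrite {1}/affine_one Order.ProdLexiOrder.ltEprodlexi => /andP[k_ge0 b_gt0] yxp.
have k0 : (l + k *+ p <= k + l)%R.
  move: yxp; rewrite Order.ProdLexiOrder.ltEprodlexi => /andP[].
  by rewrite /= affine_pow1.
have {k_ge0}k0 : k = 0%R.
  apply/eqP; rewrite eq_le k_ge0 andbT.
  (* Since [p >= 2] and [k >= 0], [k *+ p <= k] gives [k <= 0]. *)
  case: p p_gt1 k0 {yxp} => [|[|p]] // _; rewrite addrC lerD2r !mulrS.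
  by rewrite gerDl; apply: le_trans; rewrite lerDl mulrn_wge0.
move: b_gt0 yxp; rewrite {}k0 !affine_pow0 lexx /= => b_gt0.
rewrite /affine_mul !Order.ProdLexiOrder.ltEprodlexi /= addr0 add0r lexx /=.
rewrite expr0z mulr1 ![(c + _)%R]addrC !ltrD2r -!(mulr_natr b) !ltr_pM2l //.
move=> lt1 lt2.
case: l lt1 lt2 => j; last first.
  (* A negative exponent would give [n ^ l <= 1 <= p], against [lt1]. *)
  rewrite NegzE -exprz_inv => lt1 _.
  have : ((n%:R^-1 : rat) ^+ j.+1 <= 1)%R.
    by rewrite exprn_ile1 ?invr_ge0 ?ler0n // invf_le1 // ler1n ltnW.
  have : (1 <= p%:R :> rat)%R by rewrite ler1n ltnW.
  by move: lt1; rewrite -exprnP; lra.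
rewrite -exprnP -natrX !ltr_nat => lt1 lt2; exists j.
by apply/eqP; rewrite eqn_leq lt1 -ltnS lt2.
Qed.

Definition affine_zsemifield (n : nat) : algebra :=
  @adjoin_zero (int * rat) (@Order.max _ (int *l rat)) (affine_mul n%:R)
    affine_one.

Lemma affine_zsemifieldP n :
  (0 < n)%N -> is_idempotent_zsemifield (affine_zsemifield n).
Proof.
move=> n_gt0; have q_gt0 : (0 < n%:R :> rat)%R by rewrite ltr0n.
apply: (@adjoin_zero_zsemifield (int * rat) _ _ _ (affine_inv n%:R)).
- split; [exact: (@maxA _ (int *l rat)) | exact: (@maxC _ (int *l rat))|].
  exact: (@maxxx _ (int *l rat)).
- move=> x y z.
  exact: (@mono_max _ (int *l rat) _ (affine_mul_ltr q_gt0 z)).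
- move=> x y z.
  exact: (@mono_max _ (int *l rat) _ (affine_mul_ltl n%:R x)).
- split; [exact: affine_mulA | exact: affine_mul1x | exact: affine_mulx1].
- exact: affine_mulVx.
- exact: affine_mulxV.
Qed.

(** * The separating equations *)

Definition tpow (t : term) (j : nat) : term := iter j (Mul t) One.

(* The equation of the header for m = p + 1. *)
Definition power_equation (p : nat) : equation :=
  let x := Var 0 in let y := Var 1 in
  let xy := Mul x y in
  let yxp := Mul y (tpow x p) in
  let yxp2 := Mul y (tpow x p.+2) in
  let rhs := Join (Join (Mul (Mul One xy) yxp2) (Mul (Mul x yxp) yxp2))
               (Mul (Mul x xy) xy) in
  (Join (Mul (Mul x xy) yxp2) rhs, rhs).

Fixpoint eval (A : algebra) (v : nat -> A) (t : term) : A :=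
  match t with
  | Var i => v i
  | Join s t => join (eval v s) (eval v t)
  | Mul s t => mul (eval v s) (eval v t)
  | One => one
  | Zero => zero
  end.

Lemma eval_hom (A : algebra) (v : nat -> A) :
  is_hom (eval v : term_algebra -> A).
Proof. by []. Qed.

Lemma hom_eval (A : algebra) (phi : term_algebra -> A) :
  is_hom phi -> phi =1 eval (phi \o Var).
Proof.
move=> [phiJ phiM phi1 phi0]; elim=> //= [s IHs t IHt|s IHs t IHt].
- by rewrite -IHs -IHt -phiJ.
- by rewrite -IHs -IHt -phiM.
Qed.

Lemma satisfiesE (A : algebra) (eqn : equation) :
  satisfies A eqn <-> forall v : nat -> A, eval v eqn.1 = eval v eqn.2.
Proof.
split=> [sat v|sat phi phi_hom]; first exact: sat (eval_hom v).
by rewrite !(hom_eval phi_hom).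
Qed.

Lemma satisfies_power_equation (T : Type) (jn op : T -> T -> T) (e : T) p :
  satisfies (adjoin_zero jn op e) (power_equation p) <->
  forall x y : T,
    let xy := op x y in
    let yxp := op y (iter p (op x) e) in
    let yxp2 := op y (iter p.+2 (op x) e) in
    let rhs := jn (jn (op (op e xy) yxp2) (op (op x yxp) yxp2))
                 (op (op x xy) xy) in
    jn (op (op x xy) yxp2) rhs = rhs.
Proof.
have evalpow (v : nat -> adjoin_zero jn op e) x j : v 0%N = Some x ->
    eval v (tpow (Var 0) j) = Some (iter j (op x) e).
  by move=> vx; elim: j => //= j ->; rewrite vx.
rewrite satisfiesE; split=> [sat x y|sat v].
  pose v i : adjoin_zero jn op e := if i is 0%N then Some x else Some y.
  by have := sat v; rewrite /power_equation /= !(evalpow v x) // => -[].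
(* Every product contains both variables, so all of them are 0 if one is. *)
case v0 : (v 0%N) => [x|]; last by rewrite /= !v0.
case v1 : (v 1%N) => [y|]; last by rewrite /= !v0 !v1.
have := sat x y; rewrite /power_equation /= !v0 !v1 !(evalpow v x) //.
by move=> ->.
Qed.

Lemma affine_satisfies_power_equation (n p : nat) :
    (1 < n)%N -> (1 < p)%N ->
  satisfies (affine_zsemifield n) (power_equation p) <->
  ~ exists j, (n ^ j = p.+1)%N.
Proof.
move=> n_gt1 p_gt1.
have q_gt0 : (0 < n%:R :> rat)%R by rewrite ltr0n ltnW.
pose clause (x y : int *l rat) :=
  le_three_products x affine_one (affine_mul n%:R x y)
    (affine_mul n%:R y (iter p (affine_mul n%:R x) affine_one))
    (affine_mul n%:R y (iter p.+2 (affine_mul n%:R x) affine_one))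
    (affine_mul n%:R x y) (affine_mul_ltl n%:R) (affine_mul_ltr q_gt0).
rewrite satisfies_power_equation; split=> [sat [j nj]|not_pow x y].
  (* Here [x > e], and [x y = y x^(n^j) = y x^(p+1)] lies strictly between [y x^p] and [y x^(p+2)],
     so all three clauses fail. *)
  pose x : int *l rat := (0, 1)%R; pose y : int *l rat := (j%:Z, 0)%R.
  have := introT (@max_idPr _ (int *l rat) _ _) (sat x y).
  rewrite clause !affine_pow0 /affine_mul !Order.ProdLexiOrder.leEprodlexi /=.
  rewrite !addr0 !add0r mul1r lexx /=.
  by rewrite -exprnP -natrX nj !ler_nat ltnn ltnn.
apply: (elimT (@max_idPr _ (int *l rat) _ _)).
rewrite clause; apply/negPn/negP.
rewrite !negb_or -!ltNge => /and3P[x_gt1 lt1 lt2].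
exact: not_pow (affine_between n_gt1 p_gt1 x_gt1 lt1 lt2).
Qed.

(** * Counting the theories *)

Fixpoint encode_term (t : term) : GenTree.tree nat :=
  match t with
  | Var i => GenTree.Leaf i
  | Join s t => GenTree.Node 0 [:: encode_term s; encode_term t]
  | Mul s t => GenTree.Node 1 [:: encode_term s; encode_term t]
  | One => GenTree.Node 2 [::]
  | Zero => GenTree.Node 3 [::]
  end.

Lemma encode_term_inj : injective encode_term.
Proof.
elim=> [i|s IHs t IHt|s IHs t IHt||] [k|s' t'|s' t'||] //= [].
- by move=> ->.
- by move=> /IHs-> /IHt->.
- by move=> /IHs-> /IHt->.
Qed.

Lemma image_injective (T U : Type) (f : T -> U) :
  injective f -> injective (fun A : set T => f @` A).
Proof.
move=> f_inj A B AB; apply/funext => x.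
by rewrite -!(image_inj f_inj) AB.
Qed.

(** Countability of [GenTree.tree nat] yields an injective numbering of equations; direct images
    extend it to sets of equations. *)
Lemma card_sets_of_equations_le : [set: set equation] #<= [set: set nat].
Proof.
apply/pcard_injP.
pose f (eqn : equation) := pickle (encode_term eqn.1, encode_term eqn.2).
exists (fun A => f @` A) => A B _ _; apply: image_injective => -[s t] [s' t'].
by move=> /(pcan_inj pickleK)[/encode_term_inj-> /encode_term_inj->].
Qed.

(** The base is even, so an exponent of at least 2 gives a multiple of 4, which [4 * m + 6] is not;
    exponent 0 gives 1. *)
Lemma expn_4n6 n m j : ((4 * n + 6) ^ j = 4 * m + 6)%N -> n = m.
Proof.
case: j => [|[|j]]; first by rewrite expn0 addnC.
  by rewrite expn1 => /addIn/eqP; rewrite eqn_mul2l => /eqP.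
move=> pow_eq; have : 4 %| 4 * m + 6.
  rewrite -pow_eq -[j.+2]addn2 expnD dvdn_mull //.
  have -> : (4 * n + 6 = 2 * (2 * n + 3))%N by rewrite mulnDr mulnA.
  by rewrite expnMn dvdn_mulr.
by rewrite dvdn_addr ?dvdn_mulr.
Qed.

Theorem corollary5p4 :
  [set Eq K | K in [set K : set algebra | K `<=` idempotent_zsemifields]]
    #= [set: set nat].
Proof.
rewrite card_eq_le; apply/andP; split.
  exact: card_le_trans (subset_card_le (@subsetT _ _)) card_sets_of_equations_le.
pose A n := affine_zsemifield (4 * n + 6).
pose eps m := power_equation (4 * m + 5).
have Aeps n m : satisfies (A n) (eps m) <-> n <> m.
  rewrite affine_satisfies_power_equation ?ltn_addl //.
  have <- : (4 * m + 6 = (4 * m + 5).+1)%N := addnS _ 5.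
  split=> [not_pow nm|nm [j /expn_4n6//]].
  by apply: not_pow; exists 1%N; rewrite expn1 nm.
have theory_inj : injective (fun S : set nat => Eq (A @` S)).
  move=> S S' SS'; apply/funext => m; apply/propext.
  (* The theory recovers the index set: [m] belongs to it exactly when [eps m] fails. *)
  have notin (X : set nat) : Eq (A @` X) (eps m) <-> ~ X m.
    split=> [sat Xm|Xm _ [n Xn <-]]; last by apply/Aeps => nm; rewrite -nm in Xm.
    have /Aeps := sat _ (ex_intro2 _ _ m Xm erefl); exact.
  by rewrite -[S m]notK -[S' m]notK; split; apply: contra_not; rewrite -!notin SS'.
(* Lower bound: the range of this injection is as large as [set nat] and consists of theories of
   classes of 0-semifields. *)
have := inj_card_eq (A := setT) (in2W theory_inj).
rewrite card_eq_le => /andP[_ /card_le_trans]; apply; apply: subset_card_le.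
move=> _ [S _ <-]; exists (A @` S) => // _ [n _ <-].
by apply: affine_zsemifieldP; rewrite ltn_addl.
Qed.
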